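(* Let $(\Omega,\mathcal{F})$ be a measurable space, $T:\Omega\to\Omega$ measurable, and $V$ a $T$-invariant upper probability which is ergodic. Then the following are equivalent: (i) $\lim_{n\to\infty}\int\frac{1}{n}\sum_{i=0}^{n-1}1_B\cdot(1_C\circ T^i)\,dV=V(B)V(C)$ for all $B,C\in\mathcal{F}$; (ii) $V$ is a probability (i.e. $\sigma$-additive).
   Context: A capacity is a monotone map $\mu:\mathcal{F}\to[0,1]$ with $\mu(\emptyset)=0,\mu(\Omega)=1$. An upper probability is a capacity $V$ with $V(A)=\max_{P\in\Lambda}P(A)$ for a weak* (setwise convergence) compact set $\Lambda$ of probabilities. $V$ is $T$-invariant if $V(T^{-1}A)=V(A)$ for all $A$; with $\mathcal{I}=\{A:T^{-1}A=A\}$, $V$ is ergodic if for each $B\in\mathcal{I}$, $V(B)\in\{0,1\}$ and ($V(B)=0$ or $V(B^c)=0$). The integral with respect to a capacity $\mu$ is the Choquet integral $\int f\,d\mu=\int_0^\infty\mu(\{f\ge t\})dt+\int_{-\infty}^0(\mu(\{f\ge t\})-1)dt$. *)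

(* Defs.v *)
From HB Require Import structures.
From mathcomp Require Import all_boot all_order all_algebra.
From mathcomp Require Import all_classical all_reals all_analysis.
Set Implicit Arguments. Unset Strict Implicit. Unset Printing Implicit Defensive.
Import Order.TTheory GRing.Theory Num.Theory.
Import numFieldNormedType.Exports.
Local Open Scope classical_set_scope.
Local Open Scope ring_scope.

Section Defs.
Context (d : measure_display) (Omega : measurableType d) (R : realType).

Definition is_capacity (V : set Omega -> R) : Prop :=
  [/\ V set0 = 0, V setT = 1 &
      forall A B, measurable A -> measurable B -> A `<=` B -> V A <= V B].

Definition msets := {A : set Omega | measurable A}.

(* evaluation map P |-> (A |-> P(A)), into the product (pointwise) topology;
   the weak* (setwise convergence) topology on probabilities is the initial
   topology of this map, so a set of probabilities is compact in it iff its
   image under this map is compact. *)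
Definition setwise_eval (P : probability Omega R) :
  {ptws msets -> R} :=
  fun A => fine (P (proj1_sig A)).

Definition setwise_compact (L : set (probability Omega R)) : Prop :=
  compact (setwise_eval @` L).

Definition is_upper_probability (V : set Omega -> R) : Prop :=
  is_capacity V /\
  exists L : set (probability Omega R), setwise_compact L /\
    forall A, measurable A ->
      (forall P, L P -> (P A <= (V A)%:E)%E) /\
      (exists2 P, L P & P A = (V A)%:E).

Definition T_invariant (T : Omega -> Omega) (V : set Omega -> R) : Prop :=
  forall A, measurable A -> V (T @^-1` A) = V A.

Definition invariant_set (T : Omega -> Omega) (B : set Omega) : Prop :=
  measurable B /\ T @^-1` B = B.

Definition ergodic (T : Omega -> Omega) (V : set Omega -> R) : Prop :=
  forall B, invariant_set T B ->
    (V B = 0 \/ V B = 1) /\ (V B = 0 \/ V (~` B) = 0).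

Definition choquet (V : set Omega -> R) (f : Omega -> R) : \bar R :=
  (\int[lebesgue_measure]_(t in [set t : R | (0 <= t)%R]) (V [set x | (t <= f x)%R])%:E
   + \int[lebesgue_measure]_(t in [set t : R | (t < 0)%R]) (V [set x | (t <= f x)%R] - 1)%R%:E)%E.

Definition mix_avg (T : Omega -> Omega) (B C : set Omega) (n : nat) : Omega -> R :=
  fun x => n%:R^-1 * \sum_(i < n) (\1_B x * \1_C (iter i T x)).

End Defs.

Arguments mix_avg {d Omega R} T B C n x.

(* Main.v *)
Require Import Defs.
From HB Require Import structures.
From mathcomp Require Import all_boot all_order all_algebra.
From mathcomp Require Import all_classical all_reals all_analysis.
From mathcomp Require Import measurable_realfun ring lra.
Set Implicit Arguments. Unset Strict Implicit. Unset Printing Implicit Defensive.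
Import Order.TTheory GRing.Theory Num.Theory.
Import numFieldNormedType.Exports.
Local Open Scope classical_set_scope.
Local Open Scope ring_scope.

(** Let [S_n] be the frequency of visits to [C] along the first [n] steps of the
orbit. Its limsup is exactly [T]-invariant, so ergodicity makes it a constant
[c] outside a [V]-null set, and compactness of the set [L] of probabilities
(continuity of [V] from above) gives [V (S_n >= t) -> 0] for [t > c]. Tiling
orbits by blocks where the frequency is close to [c] shows, for every [P] in
[L], that the averages [P_n(C)] of the [P (T^-i C)] satisfy
[liminf P_n(C) >= c]; the invariance of [V] is what bounds the untiled part
uniformly in [i]. The same for the complement of [C] forces [S_n -> c] in
[V]-capacity and [P_n(C) -> c], hence the Choquet integrals of [1_B S_n]
converge to [V(B) c].

Thus (i) says [V(C) = c] for all [C]. Since [c] is the limit of [P_n(C)], it is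
additive under complements, so [V(C) + V(~C) = 1] and [V] coincides with [P].
Conversely an additive [V] coincides with each [P] in [L], so [P_n(C) = V(C)]
and [c = V(C)]. *)

(** * Upper probabilities: subadditivity and continuity from above *)

Lemma ptws_eval_continuous (U : Type) (W : topologicalType) (i : U) :
  continuous (fun f : {ptws U -> W} => f i).
Proof.
move=> f; have /cvg_sup/(_ i)/cvg_image : f --> f by apply: cvg_id.
move=> h; apply: cvg_trans (h _) => {h}.
  by move=> Q /= [Z nbdZ <-]; apply: filterS nbdZ; exact: preimage_image.
by rewrite eqEsubset; split => y // _; exists (fun=> y).
Qed.

Section UpperProbability.
Context {d : measure_display} {Omega : measurableType d} {R : realType}.
Context {V : set Omega -> R} {L : set (probability Omega R)}.
Context (capV : is_capacity V) (cL : setwise_compact L).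
Context (VL : forall A, measurable A ->
  (forall P, L P -> (P A <= (V A)%:E)%E) /\ (exists2 P, L P & P A = (V A)%:E)).

Lemma upper_ge P A : L P -> measurable A -> fine (P A) <= V A.
Proof.
move=> LP mA; have [/(_ _ LP) + _] := VL mA.
by rewrite -{1}(fineK (fin_num_measure P A mA)) lee_fin.
Qed.

Lemma upper_attained A : measurable A -> exists2 P, L P & fine (P A) = V A.
Proof. by move=> /VL[_ [P LP PA]]; exists P; rewrite // PA. Qed.

Lemma upper_ge0 A : measurable A -> 0 <= V A.
Proof. by move=> /upper_attained[P _ <-]; exact: fine_ge0. Qed.

Lemma upper_le1 A : measurable A -> V A <= 1.
Proof. by case: capV => _ <- mono mA; apply: mono. Qed.

Lemma upper_le A B : measurable A -> measurable B -> A `<=` B -> V A <= V B.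
Proof. by case: capV => _ _; apply. Qed.

(** Subadditivity is inherited from a [P] in [L] that attains the maximum at the union. *)
Lemma upperU_le A B : measurable A -> measurable B ->
  V (A `|` B) <= V A + V B.
Proof.
move=> mA mB; have [P LP <-] := upper_attained (measurableU _ _ mA mB).
apply: (@le_trans _ _ (fine (P A) + fine (P B))); last first.
  by rewrite lerD// upper_ge.
rewrite -fineD ?fin_num_measure//; apply: fine_le.
- by rewrite fin_num_measure//; exact: measurableU.
- by rewrite fin_numD !fin_num_measure.
- exact: measureU2.
Qed.

(** Compactness supplies continuity from above. If [V (F n)] stayed above [e], probabilities
    attaining these values would cluster at some [P] in [L] with [P (F n) >= e] for all [n],
    although [P] of the intersection is at most [V] of it, hence 0. *)
Lemma upper_cvg0 (F : nat -> set Omega) (e : R) : 0 < e ->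
  (forall n, measurable (F n)) -> {homo F : n m / (n <= m)%N >-> m `<=` n} ->
  V (\bigcap_n F n) = 0 -> \forall n \near \oo, V (F n) < e.
Proof.
move=> e0 mF ndF VF0.
have [[N VN]|/forallNP VFe] := pselect (exists N, V (F N) < e).
  near=> n; apply: le_lt_trans VN; apply: upper_le => //; apply: ndF.
  by near: n; exact: nbhs_infty_ge.
have {}VFe n : e <= V (F n) by rewrite leNgt; apply/negP.
have /choice[p Hp] n : exists P, L P /\ fine (P (F n)) = V (F n).
  by have [P] := upper_attained (mF n); exists P.
have [|q [[P LP <-] clP]] :=
  cL (fmap_proper_filter (fun n => setwise_eval (p n)) eventually_filter).
  by exists 0%N => // n _; exists (p n) => //; have [] := Hp n.
(* For [m >= n], monotonicity gives [p m (F n) >= p m (F m) = V (F m) >= e], so no such [p m] lies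
   in the open set of set functions below [e] at [F n]. *)
have PF n : e <= fine (P (F n)).
  rewrite leNgt; apply/negP => Pn.
  pose i : msets Omega := exist _ (F n) (mF n).
  have [||r [/= [m nm ->]]] := clP
    [set q | exists2 m, (n <= m)%N & q = setwise_eval (p m)]
    [set q : {ptws msets Omega -> R} | q i < e].
  - by exists n => // m /= nm; exists m.
  - exact: (cvgr_lt _ (@ptws_eval_continuous _ _ i _) _ Pn).
  - rewrite /setwise_eval/= ltNge => /negP; apply.
    apply: (le_trans (VFe m)); have [_ <-] := Hp m.
    apply: fine_le; rewrite ?fin_num_measure//.
    by apply: le_measure; rewrite ?inE//; exact: ndF.
have mcap : measurable (\bigcap_n F n) by exact: bigcapT_measurable.
have := upper_ge LP mcap; rewrite VF0 => Pcap.
have : (P \o F) @ \oo --> (fine (P (\bigcap_n F n)))%:E.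
  rewrite (fineK (fin_num_measure P _ mcap)).
  apply: nonincreasing_cvg_mu => //.
    by rewrite (le_lt_trans (probability_le1 P (mF 0%N)))// ltry.
  by move=> n m nm; apply/subsetPset; exact: ndF.
move=> /fine_cvg cvP.
have [n] := filter_ex (cvgr_lt _ cvP _ (le_lt_trans Pcap e0)).
by rewrite /= ltNge PF.
Unshelve. all: by end_near. Qed.
End UpperProbability.

(** * Orbit frequencies: tiling and the invariant limsup sets *)

Section Visits.
Context {X : Type} {R : realType} (T : X -> X).

Definition visits (C : set X) (n : nat) (x : X) : R :=
  \sum_(i < n) \1_C (iter i T x).

(** At [n = 0] this is 0, since [0^-1 = 0]; statements needing a genuine average use [n.+1]. *)
Definition visit_freq (C : set X) (n : nat) (x : X) : R :=
  n%:R^-1 * visits C n x.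

Lemma visits_ge0 C n x : 0 <= visits C n x.
Proof. by apply: sumr_ge0 => i _. Qed.

Lemma visits_le C n x : visits C n x <= n%:R.
Proof.
rewrite -[leRHS]mul1r -[X in _ <= _ * X%:R]card_ord -sumr_const big_distrr/=.
by apply: ler_sum => i _; rewrite mulr1 indicE lern1 leq_b1.
Qed.

Lemma visits_add C m n x :
  visits C (m + n) x = visits C m x + visits C n (iter m T x).
Proof.
rewrite /visits big_split_ord/=; congr +%R; apply: eq_bigr => i _.
by rewrite addnC iterD.
Qed.

Lemma visits1 C x : visits C 1 x = \1_C x.
Proof. by rewrite /visits big_ord1. Qed.

Lemma visitsC C n x : visits (~` C) n x = n%:R - visits C n x.
Proof.
rewrite -[n%:R]mul1r -[X in _ * X%:R]card_ord -sumr_const big_distrr/= -sumrB.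
apply: eq_bigr => i _; rewrite mulr1 !indicE.
by rewrite in_setC; case: (_ \in C); rewrite /= ?subrr ?subr0.
Qed.

Lemma visit_freq_ge0 C n x : 0 <= visit_freq C n x.
Proof. by rewrite mulr_ge0 ?invr_ge0 ?visits_ge0. Qed.

Lemma visit_freq_le1 C n x : visit_freq C n.+1 x <= 1.
Proof. by rewrite /visit_freq mulrC ler_pdivrMr// mul1r visits_le. Qed.

Lemma visit_freqC C n x : visit_freq (~` C) n.+1 x = 1 - visit_freq C n.+1 x.
Proof. by rewrite /visit_freq visitsC mulrBr mulVf. Qed.

(* Greedy tiling of the orbit: from a point of [E] jump over a block on which
   the frequency is at least [t]; a point outside [E] pays for itself. Only the
   last, incomplete block (of length at most [k]) is lost. *)
Lemma visits_tiling (C E : set X) (t : R) (k : nat) : 0 <= t <= 1 ->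
  (forall x, E x -> exists2 n, (0 < n <= k)%N & n%:R * t <= visits C n x) ->
  forall n x, (n%:R - k%:R) * t <= visits C n x + visits (~` E) n x.
Proof.
move=> /andP[t0 t1] Ek n; have [N] := ubnP n; elim: N n => // N IH n nN x.
have [nk|kn] := leqP n k.
  apply: (@le_trans _ _ 0); last by rewrite addr_ge0 ?visits_ge0.
  by rewrite mulr_le0_ge0// subr_le0 ler_nat.
(* A first block of length [m] satisfying the inequality without loss can be split off; the loss of
   [k] is then charged only once, to the rest of the orbit. *)
have step m : (0 < m <= n)%N -> m%:R * t <= visits C m x + visits (~` E) m x ->
    (n%:R - k%:R) * t <= visits C n x + visits (~` E) n x.
  move=> /andP[m0 mn] hm; rewrite -(subnKC mn) !visits_add natrD.
  have := IH (n - m)%N _ (iter m T x).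
  have -> : (n - m < N)%N
    by apply: (@leq_trans n) => //; rewrite ltn_subrL m0 (leq_trans m0).
  move=> /(_ isT); lra.
have [/Ek[m /andP[m0 mk] hm]|nEx] := pselect (E x).
  apply: (step m); first by rewrite m0 (leq_trans mk)// ltnW.
  by apply: le_trans hm _; rewrite lerDl visits_ge0.
apply: (step 1%N); first by rewrite (leq_trans _ kn).
rewrite visits1 (_ : visits _ _ _ = 1) ?mul1r; last first.
  by rewrite visits1 indicE mem_set.
by rewrite (le_trans t1)// lerDr indicE.
Qed.

(* The set where [limsup_n visit_freq C n.+1 x >= t]. *)
Definition limsup_ge (C : set X) (t : R) : set X :=
  \bigcap_k \bigcap_N \bigcup_(n in [set n | (N <= n)%N])
    [set x | t - k.+1%:R^-1 < visit_freq C n.+1 x].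

(** The countable definition serves measurability, this form serves estimates. *)
Lemma limsup_geP C t x : limsup_ge C t x <->
  forall e, 0 < e -> forall N, exists2 n, (N <= n)%N & t - e < visit_freq C n.+1 x.
Proof.
split=> [Wx e e0 N|Wx k _ N _].
  have [k _ /(_ _ (leqnn _))/= ke] := near_infty_natSinv_lt (PosNum e0).
  have [n Nn nt] := Wx k I N I; exists n => //.
  by apply: lt_trans nt; rewrite ltrD2l ltrN2.
by have [|n Nn nt] := Wx (k.+1%:R^-1) _ N; [rewrite invr_gt0|exists n].
Qed.

Lemma limsup_ge_le C t u : t <= u -> limsup_ge C u `<=` limsup_ge C t.
Proof.
move=> tu x /limsup_geP Wx; apply/limsup_geP => e e0 N.
by have [n Nn nu] := Wx _ e0 N; exists n => //; apply: le_lt_trans nu; rewrite lerD2r.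
Qed.

(** The difference equals the indicator at [x] minus a frequency, both in [0,1], divided by
    [n.+2]. *)
Lemma visit_freq_shift C n x :
  `|visit_freq C n.+2 x - visit_freq C n.+1 (T x)| <= n.+2%:R^-1.
Proof.
have -> : visit_freq C n.+2 x - visit_freq C n.+1 (T x) =
    n.+2%:R^-1 * (\1_C x - visit_freq C n.+1 (T x)).
  rewrite /visit_freq -(add1n n.+1) visits_add visits1/= add1n.
  have -> : n.+2%:R = n.+1%:R + 1 :> R by rewrite natr1.
  have : 0 < n.+1%:R :> R by [].
  move: n.+1%:R => p p0; field.
  by apply/andP; split; rewrite gt_eqF// addr_gt0.
rewrite normrM ger0_norm ?invr_ge0// ler_piMr ?invr_ge0//.
rewrite ler_norml; have := visit_freq_ge0 C n.+1 (T x).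
have := visit_freq_le1 C n (T x).
by rewrite indicE; case: (x \in C); rewrite /= => *; apply/andP; split; lra.
Qed.

(** Ergodicity concerns strictly invariant sets, hence an equality of sets. The shift error drops
    below [e / 2] for large [n], and the other half of [e] is the slack in the limsup. *)
Lemma limsup_ge_invariant C t : T @^-1` limsup_ge C t = limsup_ge C t.
Proof.
have small e : 0 < e :> R -> exists M : nat, forall n, (M <= n)%N -> n.+2%:R^-1 < e.
  move=> e0; have [k _ ke] := near_infty_natSinv_lt (PosNum e0).
  by exists k => n kn; apply: (ke n.+1); rewrite /= ltnW.
apply/seteqP; split => x /limsup_geP Wx; apply/limsup_geP => e e0 N.
  have e20 : 0 < e / 2 by rewrite divr_gt0.
  have [M Me] := small _ e20.
  have [n] := Wx _ e20 (maxn M N); rewrite geq_max => /andP[Mn Nn] nt.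
  exists n.+1; first exact: leqW.
  have := visit_freq_shift C n x; rewrite ler_norml => /andP[].
  by have := Me _ Mn; move: nt (n.+2%:R^-1) => + r *; lra.
have e20 : 0 < e / 2 by rewrite divr_gt0.
have [M Me] := small _ e20.
(* The successor in the bound excludes index 0, so the index has a predecessor to use at [T x]. *)
have [[|n]] := Wx _ e20 (maxn M N).+1; rewrite // ltnS geq_max => /andP[Mn Nn] nt.
exists n => //.
have := visit_freq_shift C n x; rewrite ler_norml => /andP[].
by have := Me _ Mn; move: nt (n.+2%:R^-1) => + r *; lra.
Qed.

End Visits.

(** * Measurability, and averages of a probability along preimages *)

Section MeasurableVisits.
Context {d : measure_display} {Omega : measurableType d} {R : realType}.

Lemma measurable_superlevel (f : Omega -> R) (t : R) :
  measurable_fun setT f -> measurable [set x | t <= f x].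
Proof.
move=> mf; rewrite -[X in measurable X]setTI.
have -> : [set x | t <= f x] = f @^-1` `[t, +oo[.
  by apply/seteqP; split=> x; rewrite /= in_itv/= andbT.
exact: mf.
Qed.

Lemma measurable_strict_superlevel (f : Omega -> R) (t : R) :
  measurable_fun setT f -> measurable [set x | t < f x].
Proof.
move=> mf; rewrite -[X in measurable X]setTI.
have -> : [set x | t < f x] = f @^-1` `]t, +oo[.
  by apply/seteqP; split=> x; rewrite /= in_itv/= andbT.
exact: mf.
Qed.

Context {T : Omega -> Omega} (mT : measurable_fun setT T).

Lemma measurable_iter i : measurable_fun setT (iter i T).
Proof.
by elim: i => [|i IH]; [exact: measurable_id|exact: (measurableT_comp mT IH)].
Qed.

Lemma measurable_preimage_iter C i :
  measurable C -> measurable (iter i T @^-1` C).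
Proof. by move=> mC; rewrite -[X in measurable X]setTI; exact: measurable_iter. Qed.

Lemma measurable_visits (C : set Omega) n : measurable C ->
  measurable_fun setT (visits T C n : Omega -> R).
Proof.
move=> mC; apply: measurable_sum => i.
by apply: (measurableT_comp (measurable_indic mC)); exact: measurable_iter.
Qed.

Lemma measurable_visit_freq (C : set Omega) n : measurable C ->
  measurable_fun setT (visit_freq T C n : Omega -> R).
Proof.
by move=> mC; apply: measurable_funM => //; exact: measurable_visits.
Qed.

Lemma measurable_limsup_ge (C : set Omega) (t : R) : measurable C ->
  measurable (limsup_ge T C t).
Proof.
move=> mC; apply: bigcapT_measurable => k; apply: bigcapT_measurable => N.
apply: bigcup_measurable => n _; apply: measurable_strict_superlevel.
exact: measurable_visit_freq.
Qed.

Lemma integral_visits (P : probability Omega R) C n : measurable C ->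
  (\int[P]_x (visits T C n x)%:E)%E =
  (\sum_(i < n) fine (P (iter i T @^-1` C)))%:E.
Proof.
move=> mC; rewrite /visits; under eq_integral do rewrite -sumEFin.
rewrite ge0_integral_sum//=; last first.
  move=> i; apply/measurable_EFinP.
  by apply: (measurableT_comp (measurable_indic mC)); exact: measurable_iter.
rewrite -sumEFin; apply: eq_bigr => i _.
have mi := measurable_preimage_iter i mC.
rewrite fineK ?fin_num_measure//.
by rewrite -[X in P X]setIT -integral_indic.
Qed.

(** Integrating a pointwise bound against [P]; this carries the tiling estimate over to measures. *)
Lemma visits_sum_ge (P : probability Omega R) C D n (a : R) :
  measurable C -> measurable D ->
  (forall x, a <= visits T C n x + visits T D n x) ->
  a <= \sum_(i < n) fine (P (iter i T @^-1` C)) +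
       \sum_(i < n) fine (P (iter i T @^-1` D)).
Proof.
move=> mC mD aCD; rewrite -lee_fin EFinD -!integral_visits//.
rewrite -ge0_integralD//=; last 4 first.
- by move=> x _; rewrite lee_fin visits_ge0.
- by apply/measurable_EFinP; exact: measurable_visits.
- by move=> x _; rewrite lee_fin visits_ge0.
- by apply/measurable_EFinP; exact: measurable_visits.
(* Comparison with the constant function [a] is done for nonnegative integrands, so [a <= 0] is
   treated apart. *)
have [a0|a0] := leP a 0.
  apply: (@le_trans _ _ 0%E); first by rewrite lee_fin.
  by apply: integral_ge0 => x _; rewrite -EFinD lee_fin addr_ge0 ?visits_ge0.
rewrite -[a%:E]mule1 -(@probability_setT _ _ _ P) -integral_cst//.
apply: ge0_le_integral => //=.
- by move=> x _; rewrite lee_fin ltW.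
- apply/measurable_EFinP; apply: measurable_funD; exact: measurable_visits.
- by move=> x _; rewrite -EFinD lee_fin.
Qed.

(** This is [P_n(C)]: the Cesaro mean of the push-forwards of [P] under the iterates of [T],
    evaluated at [C]. *)
Definition mean_measure (P : probability Omega R) (C : set Omega) (n : nat) : R :=
  n%:R^-1 * \sum_(i < n) fine (P (iter i T @^-1` C)).

Lemma mean_measureC P C n : measurable C ->
  mean_measure P (~` C) n.+1 = 1 - mean_measure P C n.+1.
Proof.
move=> mC; rewrite /mean_measure.
have -> : \sum_(i < n.+1) fine (P (iter i T @^-1` ~` C)) =
    \sum_(i < n.+1) (1 - fine (P (iter i T @^-1` C))).
  apply: eq_bigr => i _; rewrite preimage_setC probability_setC; last first.
    exact: measurable_preimage_iter.
  by rewrite fineB// fin_num_measure//; exact: measurable_preimage_iter.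
by rewrite sumrB sumr_const card_ord mulrBr mulVf.
Qed.

End MeasurableVisits.
Arguments mean_measure {d Omega R} T P C n.

(** * Ergodicity: the constant limsup and one-sided asymptotic bounds *)

Section ErgodicUpper.
Context {d : measure_display} {Omega : measurableType d} {R : realType}.
Context {T : Omega -> Omega} (mT : measurable_fun setT T).
Context {V : set Omega -> R} {L : set (probability Omega R)}.
Context (capV : is_capacity V) (cL : setwise_compact L).
Context (VL : forall A, measurable A ->
  (forall P, L P -> (P A <= (V A)%:E)%E) /\ (exists2 P, L P & P A = (V A)%:E)).
Context (invV : T_invariant T V) (ergV : ergodic T V).

Lemma upper_preimage_iter A i : measurable A -> V (iter i T @^-1` A) = V A.
Proof.
move=> mA; elim: i => [|i IH]//; rewrite -IH -(invV (measurable_preimage_iter mT i mA)).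
by congr V; apply/seteqP; split=> x; rewrite /preimage/= -iterSr.
Qed.

(* The value [c] is the almost sure value of [limsup visit_freq C]. *)
Lemma limsup_constant C : measurable C ->
  exists c : R, [/\ 0 <= c <= 1,
    forall t, c < t -> V (limsup_ge T C t) = 0 &
    forall t, t < c -> V (~` limsup_ge T C t) = 0].
Proof.
move=> mC; have mW (t : R) := measurable_limsup_ge mT t mC.
have mW' (t : R) := measurableC (mW t).
(* The constant is the supremum of the levels reached by the limsup off a [V]-null set. *)
pose S := [set t : R | V (~` limsup_ge T C t) = 0].
have S0 : S 0.
  rewrite /S/= (_ : limsup_ge T C 0 = setT) ?setCT; first by case: capV.
  apply/seteqP; split=> // x _; apply/limsup_geP => e e0 N; exists N => //.
  by have := visit_freq_ge0 (R:=R) T C N.+1 x; lra.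
have ubS : ubound S 1.
  move=> t St; rewrite leNgt; apply/negP => t1; move: St; rewrite /S/=.
  rewrite (_ : limsup_ge T C t = set0) ?setC0.
    by case: capV => _ -> _; apply/eqP; rewrite oner_eq0.
  apply/seteqP; split=> // x /limsup_geP Wx.
  have [|n _] := Wx (t - 1) _ 0%N; first lra.
  by have := visit_freq_le1 (R:=R) T C n x; lra.
have hS : has_sup S by split; [exists 0|exists 1].
exists (sup S); split => [|t ct|t tc].
- by rewrite (sup_upper_bound hS S0) sup_le_ub//; exists 0.
(* By ergodicity the set or its complement is null; the latter would put [t > sup S] into [S]. *)
- have [_ [//|St]] := ergV (conj (mW t) (limsup_ge_invariant T C t)).
  by have := sup_upper_bound hS St; lra.
- have [|u Su tu] := sup_gt _ tc; first by exists 0.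
  apply/eqP; rewrite eq_le (upper_ge0 VL)// andbT -Su (upper_le capV)//.
  by apply: subsetC; apply: limsup_ge_le; exact: ltW.
Qed.

(** The sets where the frequency reaches [t] at some time from [N] on decrease to a subset of the
    null set [limsup_ge T C t], so continuity from above applies. *)
Lemma visit_freq_capacity C (c t : R) : measurable C ->
  (forall u, c < u -> V (limsup_ge T C u) = 0) -> c < t ->
  forall e, 0 < e -> \forall n \near \oo, V [set x | t <= visit_freq T C n.+1 x] < e.
Proof.
move=> mC Vc ct e e0.
have mS n : measurable [set x | t <= visit_freq T C n.+1 x].
  by apply: measurable_superlevel; exact: measurable_visit_freq.
pose F N := \bigcup_(n in [set n | (N <= n)%N]) [set x | t <= visit_freq T C n.+1 x].
have mF N : measurable (F N) by exact: bigcup_measurable.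
have : \forall n \near \oo, V (F n) < e.
  apply: (upper_cvg0 capV cL VL) => //.
    by move=> n m nm x [k /= mk xk]; exists k => //=; exact: leq_trans mk.
  apply/eqP; rewrite eq_le (upper_ge0 VL) ?andbT; last exact: bigcapT_measurable.
  rewrite -(Vc _ ct) (upper_le capV)//; first exact: bigcapT_measurable.
    exact: measurable_limsup_ge.
  move=> x Fx; apply/limsup_geP => a a0 N; have [n /= Nn tn] := Fx N I.
  by exists n => //; lra.
apply: filterS => n VFn; apply: le_lt_trans VFn; apply: (upper_le capV) => // x tx.
by exists n => /=.
Qed.

Lemma mean_measure_ge C (c t : R) P : measurable C -> L P -> c <= 1 ->
  (forall u, u < c -> V (~` limsup_ge T C u) = 0) -> t < c ->
  \forall n \near \oo, t <= mean_measure T P C n.+1.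
Proof.
move=> mC LP c1 Vc tc.
have [t0|t0] := leP t 0.
  exists 0%N => // n _ /=.
  apply: (le_trans t0); apply: mulr_ge0; first by rewrite invr_ge0.
  by apply: sumr_ge0 => i _; exact: fine_ge0.
(* [u < c] makes the limsup reach [u] off a null set, and [s < u] leaves room for a block of
   frequency above [s]. As [t > 0], also [s >= 0], which the tiling requires. *)
pose u := (t + c) / 2; pose s := (t + u) / 2.
have [tu uc ts su] : [/\ t < u, u < c, t < s & s < u].
  by rewrite /s/u; split; lra.
pose E k := \bigcup_(n in [set n | (n <= k)%N]) [set x | s < visit_freq T C n.+1 x].
have mE k : measurable (E k).
  apply: bigcup_measurable => n _; apply: measurable_strict_superlevel.
  exact: measurable_visit_freq.
have mE' k := measurableC (mE k).
(* Half of the gap [s - t] pays for the points outside [E k], half for the incomplete last block. *)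
pose e := (s - t) / 2; have e0 : 0 < e by rewrite /e; lra.
have [k Vk] : exists k, V (~` E k) < e.
  suff /filter_ex : \forall k \near \oo, V (~` E k) < e by [].
  apply: (upper_cvg0 capV cL VL) => //.
    move=> n m nm; apply: subsetC => x [k /= kn xk]; exists k => //=.
    exact: leq_trans nm.
  apply/eqP; rewrite eq_le (upper_ge0 VL) ?andbT; last exact: bigcapT_measurable.
  rewrite -(Vc _ uc) (upper_le capV)//; first exact: bigcapT_measurable.
    by apply: measurableC; exact: measurable_limsup_ge.
  move=> x Ex /limsup_geP Wx.
  have [|n _ xn] := Wx (u - s) _ 0%N; first lra.
  by apply: (Ex n I); exists n => //=; lra.
have s1 : 0 <= s <= 1 by apply/andP; split; lra.
(* Indices [m <= k] in [E k] give blocks of length [m.+1], hence the bound [k.+1]. *)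
have tile n x : (n.+1%:R - k.+1%:R) * s <= visits T C n.+1 x + visits T (~` E k) n.+1 x.
  apply: visits_tiling => // y [m /= mk ym]; exists m.+1; first by rewrite /= ltnS.
  rewrite mulrC -ler_pdivlMr// mulrC; exact: ltW.
have Pn n := visits_sum_ge mT P mC (mE' k) (tile n).
have nk : \forall n \near \oo, n.+1%:R^-1 < e / k.+1%:R.
  have ek : 0 < e / k.+1%:R by rewrite divr_gt0.
  exact: near_infty_natSinv_lt (PosNum ek).
apply: filterS nk => n; rewrite ltr_pdivlMr// => nk.
have PE : \sum_(i < n.+1) fine (P (iter i T @^-1` ~` E k)) <= n.+1%:R * e.
  rewrite mulrC -[X in _ <= _ * X%:R]card_ord -sumr_const big_distrr/=.
  apply: ler_sum => i _; rewrite mulr1.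
  apply: le_trans (ltW Vk); rewrite -(upper_preimage_iter i (mE' k)).
  by apply: (upper_ge VL) => //; exact: measurable_preimage_iter.
rewrite /mean_measure mulrC ler_pdivlMr//; have := Pn n.
move: nk; rewrite mulrC ltr_pdivrMr// => nk.
have : k.+1%:R * s <= k.+1%:R by rewrite ler_piMr//; case/andP: s1.
move: PE nk; rewrite /e; move: n.+1%:R k.+1%:R (\sum_(i < _) _) (\sum_(i < _) _).
by move=> N K A B *; lra.
Qed.
End ErgodicUpper.

(** * Bounds for Choquet integrals of nonnegative functions *)

Section Choquet.
Context {d : measure_display} {Omega : measurableType d} {R : realType}.
Context {V : set Omega -> R} (capV : is_capacity V).
Context {f : Omega -> R} (mf : measurable_fun setT f).
Context (f0 : forall x, 0 <= f x).

Let phi t := V [set x | t <= f x].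
Let mphi D : measurable D -> measurable_fun D (fun t => (phi t)%:E).
Proof.
move=> mD; apply/measurable_EFinP; apply: nonincreasing_measurable => // s t st.
case: capV => _ _; apply; try exact: measurable_superlevel.
by move=> x /=; exact: le_trans.
Qed.

Let phi_ge0 t : 0 <= phi t.
Proof.
case: capV => <- _; apply => //; exact: measurable_superlevel.
Qed.

(** For [t < 0] the superlevel set is the whole space, so the second integrand vanishes. The
    endpoint 0 is dropped so that bounds valid only for [t > 0] can be used. *)
Lemma choquet_ge0E : choquet V f =
  (\int[lebesgue_measure]_(t in `]0%R, +oo[) (V [set x | (t <= f x)%R])%:E)%E.
Proof.
rewrite /choquet [X in (_ + X)%E]integral0_eq ?adde0.
  rewrite integral_itv_obnd_cbnd; last exact: mphi.
  by congr integral; apply/seteqP; split=> t; rewrite /= in_itv/= andbT.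
move=> t /= t0; rewrite (_ : [set x | _] = setT).
  by case: capV => _ -> _; rewrite subrr.
by apply/seteqP; split=> // x _ /=; rewrite (le_trans (ltW t0)).
Qed.

(** Markov's inequality: on []0, l]] the nonincreasing integrand is at least its value at [l]. *)
Lemma choquet_ge (l : R) : 0 <= l ->
  ((l * V [set x | l <= f x])%:E <= choquet V f)%E.
Proof.
move=> l0; rewrite choquet_ge0E.
apply: (@le_trans _ _
  (\int[lebesgue_measure]_(t in `]0%R, l]) (V [set x | (t <= f x)%R])%:E)%E); last first.
  apply: ge0_subset_integral => //; first exact: mphi.
    by move=> t _; rewrite lee_fin phi_ge0.
  by move=> t; rewrite /= !in_itv/= => /andP[->].
apply: (@le_trans _ _ (\int[lebesgue_measure]_(t in `]0%R, l]) cst (phi l)%:E t)%E).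
  rewrite integral_cst//= lebesgue_measure_itv/= lte_fin.
  case: ltP => [_|l0']; first by rewrite sube0 -EFinM mulrC.
  by rewrite (le_anti (introT andP (conj l0' l0))) mul0r mule0.
apply: ge0_le_integral => //.
- by move=> t _; rewrite /= lee_fin phi_ge0.
- exact: mphi.
- move=> t /=; rewrite in_itv/= lee_fin => /andP[_ tl].
  case: capV => _ _; apply; try exact: measurable_superlevel.
  by move=> x /=; exact: le_trans.
Qed.

(** The integrand vanishes beyond 1, and is dominated by [v] times the indicator of []0, u]] plus
    [w] times that of []0, 1]]. *)
Lemma choquet_le (u v w : R) : (forall x, f x <= 1) ->
  0 <= u -> 0 <= v -> 0 <= w ->
  (forall t, 0 < t -> V [set x | t <= f x] <= v) ->
  V [set x | u <= f x] <= w ->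
  (choquet V f <= (u * v + w)%:E)%E.
Proof.
move=> f1 u0 v0 w0 Vv Vw; rewrite choquet_ge0E.
have itvI (a : R) : 0 <= a ->
    lebesgue_measure (`]0, a] `&` `]0, +oo[ : set R) = a%:E.
  move=> a0; rewrite (_ : _ `&` _ = `]0, a]%classic); last first.
    by rewrite setIidl// => t; rewrite /= !in_itv/= => /andP[->].
  rewrite lebesgue_measure_itv/= lte_fin; case: ltP => [_|a0']; first by rewrite sube0.
  by rewrite (le_anti (introT andP (conj a0' a0))).
have int_indic (a b : R) : 0 <= a -> 0 <= b ->
    (\int[lebesgue_measure]_(t in `]0%R, +oo[) (b%:E * (\1_(`]0, a] : set R) t)%:E) = (a * b)%:E)%E.
  move=> a0 b0; rewrite ge0_integralZl//; last first.
    by apply/measurable_EFinP; exact: measurable_indic.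
  by rewrite integral_indic//= itvI// -EFinM mulrC.
rewrite -[w in X in (_ <= X)%E]mul1r EFinD -!int_indic// -ge0_integralD//; last 4 first.
- by move=> t _; rewrite -EFinM lee_fin mulr_ge0.
- by apply: measurable_funeM; apply/measurable_EFinP; exact: measurable_indic.
- by move=> t _; rewrite -EFinM lee_fin mulr_ge0.
- by apply: measurable_funeM; apply/measurable_EFinP; exact: measurable_indic.
apply: ge0_le_integral => //.
- by move=> t _; rewrite lee_fin phi_ge0.
- exact: mphi.
- by apply: emeasurable_funD; apply: measurable_funeM; apply/measurable_EFinP;
    exact: measurable_indic.
move=> t; rewrite /= in_itv/= andbT => t0.
rewrite -!EFinM -EFinD lee_fin !indicE !mem_setE !in_itv/= t0/=.
have [t1|t1] := leP t 1; last first.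
  rewrite (_ : [set x | t <= f x] = set0).
    by case: capV => -> _ _; rewrite addr_ge0 ?mulr_ge0.
  by apply/seteqP; split => // x /= /le_trans/(_ (f1 x)); rewrite leNgt t1.
have [tu|tu] := leP t u; rewrite /= mulr1.
  by rewrite mulr1 (le_trans (Vv _ t0))// lerDl.
rewrite mulr0 add0r; apply: le_trans Vw.
case: capV => _ _; apply; try exact: measurable_superlevel.
by move=> x /=; apply: le_trans; exact: ltW.
Qed.

End Choquet.

(** * Two-sided limits of frequencies, means and Choquet integrals *)

Section ErgodicAverages.
Context {d : measure_display} {Omega : measurableType d} {R : realType}.
Context {T : Omega -> Omega} (mT : measurable_fun setT T).
Context {V : set Omega -> R} {L : set (probability Omega R)}.
Context (capV : is_capacity V) (cL : setwise_compact L).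
Context (VL : forall A, measurable A ->
  (forall P, L P -> (P A <= (V A)%:E)%E) /\ (exists2 P, L P & P A = (V A)%:E)).
Context (invV : T_invariant T V) (ergV : ergodic T V).

(** The one-sided bounds for [C] and for its complement, with constants [c] and [c'], become
    two-sided once [c = 1 - c'] is known. *)
Lemma ergodic_value C : measurable C ->
  exists c : R, [/\ 0 <= c <= 1,
    forall t e, c < t -> 0 < e ->
      \forall n \near \oo, V [set x | t <= visit_freq T C n.+1 x] < e,
    forall t e, t < c -> 0 < e ->
      \forall n \near \oo, V [set x | visit_freq T C n.+1 x <= t] < e &
    forall P, L P -> mean_measure T P C n.+1 @[n --> \oo] --> c].
Proof.
move=> mC; have mC' := measurableC mC.
have mS D t n : measurable D -> measurable [set x | t <= visit_freq T D n.+1 x :> R].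
  by move=> mD; apply: measurable_superlevel; exact: measurable_visit_freq.
have [c [c01 cgt clt]] := limsup_constant mT capV VL ergV mC.
have [c' [c'01 c'gt c'lt]] := limsup_constant mT capV VL ergV mC'.
have /andP[c0 c1] := c01; have /andP[c'0 c'1] := c'01.
have Sle t e : 1 - c' > t -> 0 < e ->
    \forall n \near \oo, V [set x | visit_freq T C n.+1 x <= t] < e.
  move=> tc e0; have ct : c' < 1 - t by lra.
  have := visit_freq_capacity mT capV cL VL mC' c'gt ct e0.
  apply: filterS => n; rewrite (_ : [set x | 1 - t <= _] = [set x | visit_freq T C n.+1 x <= t])//.
  by apply/seteqP; split=> x /=; rewrite visit_freqC; lra.
have mle P t : L P -> 1 - c' < t -> \forall n \near \oo, mean_measure T P C n.+1 <= t.
  move=> LP tc; have ct : 1 - t < c' by lra.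
  have := mean_measure_ge mT capV cL VL invV mC' LP c'1 c'lt ct.
  by apply: filterS => n; rewrite mean_measureC//; lra.
have cc' : c = 1 - c'.
  apply/eqP; rewrite eq_le; apply/andP; split; rewrite leNgt; apply/negP => cc.
    (* If [1 - c' < c], the means [P_n(C)] would eventually be at most [t] and at least [u > t]. *)
    have [P LP _] := upper_attained VL measurableT.
    pose t := (c + (1 - c')) / 2; pose u := (c + t) / 2.
    have [ct uc tu] : [/\ 1 - c' < t, u < c & t < u] by rewrite /u /t; split; lra.
    have [n [h1 h2]] := filter_ex (filterI (mle P t LP ct)
      (mean_measure_ge mT capV cL VL invV mC LP c1 clt uc)).
    by move: h1 h2 => /= h1 h2; lra.
  (* If [c < 1 - c'], the events of frequency at most [t] and at least [t] cover the space, yet each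
     eventually has capacity below 1/2. *)
  pose t := (c + (1 - c')) / 2.
  have [ct tc] : c < t /\ t < 1 - c' by rewrite /t; split; lra.
  have h0 : 0 < 1 / 2 :> R by lra.
  have [n [h1 h2]] := filter_ex (filterI (Sle t _ tc h0)
      (visit_freq_capacity mT capV cL VL mC cgt ct h0)).
  have mA : measurable [set x | visit_freq T C n.+1 x <= t].
    rewrite (_ : [set x | _] = [set x | 1 - t <= visit_freq T (~` C) n.+1 x]); first exact: mS.
    by apply/seteqP; split=> x /=; rewrite visit_freqC; lra.
  have := upperU_le VL mA (mS C t n mC).
  rewrite (_ : _ `|` _ = setT); last first.
    by apply/seteqP; split=> // x _ /=; apply/orP; exact: le_total.
  by case: (capV) => _ -> _; move: h1 h2 => /= h1 h2; lra.
exists c; split => //.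
- move=> t e ct e0; exact: (visit_freq_capacity mT capV cL VL mC cgt ct e0).
- by move=> t e tc; apply: Sle; rewrite -cc'.
- move=> P LP; apply/cvgrPdist_le => e e0.
  have ce : 1 - c' < c + e by lra.
  have ce' : c - e < c by lra.
  apply: filterS (filterI (mle P _ LP ce)
      (mean_measure_ge mT capV cL VL invV mC LP c1 clt ce')) => n [h1 h2].
  by rewrite ler_norml; apply/andP; split; lra.
Qed.

Lemma mix_avgE B C n x : mix_avg T B C n x = \1_B x * visit_freq T C n x :> R.
Proof. by rewrite /mix_avg /visit_freq /visits -big_distrr/= mulrCA. Qed.

Lemma cvg_EFin_near (u : nat -> \bar R) (l : R) :
  (forall e, 0 < e -> \forall n \near \oo, ((l - e)%:E <= u n <= (l + e)%:E)%E) ->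
  u @ \oo --> l%:E.
Proof.
move=> ul; apply/fine_cvgP; split.
  apply: filterS (ul 1 ltr01) => n.
  by case: (u n) => [r| |]//=; rewrite ?leye_eq ?leeNy_eq ?andbF.
apply/cvgrPdist_le => e e0; apply: filterS (ul e e0) => n /=.
case: (u n) => [r| |]//=; rewrite ?leye_eq ?leeNy_eq ?andbF//.
by rewrite !lee_fin ler_norml => /andP[? ?]; apply/andP; split; lra.
Qed.

(** [mix_avg] is the indicator of [B] times the frequency, which exceeds [c] by [e / 2] or falls
    short of it by as much only on sets of capacity below [e / 2]. *)
Lemma choquet_mix_avg_cvg C : measurable C ->
  exists2 c : R,
    forall B, measurable B ->
      choquet V (mix_avg T B C n.+1) @[n --> \oo] --> (V B * c)%:E &
    forall P, L P -> mean_measure T P C n.+1 @[n --> \oo] --> c.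
Proof.
move=> mC; have [c [/andP[c0 c1] Sge Sle Pc]] := ergodic_value mC.
exists c => // B mB; apply: cvg_EFin_near => e e0.
have VB0 := upper_ge0 VL mB; have VB1 := upper_le1 capV mB.
have e20 : 0 < e / 2 by lra.
have ce : c < c + e / 2 by lra.
have ce' : c - e / 2 < c by lra.
apply: filterS (filterI (Sge _ _ ce e20) (Sle _ _ ce' e20)) => n [h1 h2].
pose f : Omega -> R := mix_avg T B C n.+1.
have mf : measurable_fun setT f.
  rewrite (_ : f = fun x => \1_B x * visit_freq T C n.+1 x); last first.
    by apply/funext => x; exact: mix_avgE.
  apply: measurable_funM; first exact: measurable_indic.
  exact: measurable_visit_freq.
have mS t : measurable [set x | t <= visit_freq T C n.+1 x :> R].
  by apply: measurable_superlevel; exact: measurable_visit_freq.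
have f0 x : 0 <= f x by rewrite /f mix_avgE mulr_ge0 ?visit_freq_ge0.
have fS x : f x <= visit_freq T C n.+1 x.
  rewrite /f mix_avgE; apply: ler_piMl; first exact: visit_freq_ge0.
  by rewrite indicE lern1 leq_b1.
have f1 x : f x <= 1 by rewrite (le_trans (fS x))// visit_freq_le1.
apply/andP; split.
  (* If [c <= e / 2], the lower bound [V B * c - e] is negative and nothing is to be shown beyond
     nonnegativity. *)
  have [ce0|ce0] := leP (c - e / 2) 0.
    apply: (@le_trans _ _ (0 * V [set x | 0 <= f x])%:E); last exact: choquet_ge.
    by rewrite mul0r lee_fin; nra.
  apply: le_trans (choquet_ge capV mf f0 (ltW ce0)).
  set l := c - e / 2 in h2 ce' ce0 *.
  have mA : measurable [set x | visit_freq T C n.+1 x <= l].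
    rewrite (_ : [set x | _] = ~` [set x | l < visit_freq T C n.+1 x]).
      by apply: measurableC; apply: measurable_strict_superlevel; exact: measurable_visit_freq.
    by apply/seteqP; split=> x /=; rewrite leNgt => /negP.
  (* A point of [B] has [f >= l] or frequency at most [l]; the latter event has small capacity. *)
  have VBl : V B <= V [set x | l <= f x] + e / 2.
    apply: le_trans (_ : _ <= V ([set x | l <= f x] `|` [set x | visit_freq T C n.+1 x <= l])) _.
      apply: (upper_le capV) => //.
        by apply: measurableU => //; exact: measurable_superlevel.
      move=> x Bx /=; rewrite /f mix_avgE indicE mem_set// mul1r.
      by apply/orP; exact: le_total.
    apply: le_trans (upperU_le VL _ mA) _; first exact: measurable_superlevel.
    by rewrite lerD2l ltW.
  rewrite lee_fin; move: (V [set x | l <= f x]) VBl => W VBl.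
  have h3 : l * V B <= l * (W + e / 2) by rewrite ler_wpM2l// ltW.
  have h4 : l * (e / 2) <= e / 2 by rewrite ler_piMl//; rewrite /l; lra.
  have h5 : e / 2 * V B <= e / 2 by rewrite ler_piMr//; lra.
  by rewrite /l in h3 h4 *; lra.
(* Positive superlevel sets of [f] lie in [B], giving [v = V B]; at level [c + e / 2] they have
   capacity below [w = e / 2]. *)
apply: le_trans (_ : ((c + e / 2) * V B + e / 2)%:E <= _)%E.
  apply: choquet_le => //; [lra|lra| |].
  - move=> t t0; apply: (upper_le capV) => //; first exact: measurable_superlevel.
    move=> x /=; rewrite /f mix_avgE indicE; case: (boolP (x \in B)) => [/set_mem//|_].
    by rewrite mul0r leNgt t0.
  - apply: le_trans (ltW h1); apply: (upper_le capV) => //.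
      exact: measurable_superlevel.
    by move=> x /= /le_trans; apply.
have h5 : e / 2 * V B <= e / 2 by rewrite ler_piMr//; lra.
by rewrite lee_fin; lra.
Qed.

(* Each [P] in [L] satisfies [P A <= V A] and [P (~` A) <= V (~` A)]; when the
   right-hand sides sum to 1 both are equalities. *)
Lemma upper_selfconjugate P A : L P -> measurable A ->
  V A + V (~` A) = 1 -> P A = (V A)%:E.
Proof.
move=> LP mA VA; rewrite -(fineK (fin_num_measure P A mA)); congr EFin.
have mA' := measurableC mA.
have := upper_ge VL LP mA; have := upper_ge VL LP mA'.
rewrite probability_setC// fineB ?fin_num_measure//= => h1 h2.
by apply/eqP; rewrite eq_le h2/=; lra.
Qed.

End ErgodicAverages.

(** * Product limits of Choquet integrals versus additivity of [V] *)

Theorem proposition4p2 (d : measure_display) (Omega : measurableType d)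
  (R : realType) (T : Omega -> Omega) (V : set Omega -> R) :
  measurable_fun setT T ->
  is_upper_probability V ->
  T_invariant T V ->
  ergodic T V ->
  (forall B C : set Omega, measurable B -> measurable C ->
     (fun n => choquet V (mix_avg T B C n.+1)) @ \oo --> ((V B * V C)%:E))
  <-> semi_sigma_additive (fun A => (V A)%:E).
Proof.
move=> mT [capV [L [cL VL]]] invV ergV.
have cvC := choquet_mix_avg_cvg mT capV cL VL invV ergV.
have [P LP _] := upper_attained VL measurableT.
have [V0 V1 _] := capV.
split=> [mix|sigmaV].
  have meanV C : measurable C -> mean_measure T P C n.+1 @[n --> \oo] --> V C.
    move=> mC; have [c cvB /(_ _ LP)] := cvC C mC.
    (* With [B] the whole space, condition (i) has limit [V C], while the same integrals tend to
       [c]. *)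
    suff -> : c = V C by [].
    have := mix _ _ measurableT mC; have := cvB _ measurableT.
    rewrite V1 !mul1r => /cvg_lim h1 /cvg_lim h2.
    by apply: EFin_inj; rewrite -h1// -h2.
  have VE A : measurable A -> P A = (V A)%:E.
    move=> mA; apply: (upper_selfconjugate VL LP mA).
    (* The means of the complement of [A] tend to its [V]-value and also to [1 - V A]. *)
    have := meanV _ (measurableC mA).
    have -> : (fun n => mean_measure T P (~` A) n.+1) =
        (fun n => 1 - mean_measure T P A n.+1).
      by apply/funext => n; exact: mean_measureC.
    have : (fun n => 1 - mean_measure T P A n.+1) @ \oo --> 1 - V A.
      by apply: cvgB; [exact: cvg_cst|exact: meanV].
    move=> /cvg_lim h1 /cvg_lim h2.
    by have := h1 (@Rhausdorff R); rewrite h2 // => ->; lra.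
  move=> F mF tF mU; rewrite -VE//.
  under eq_fun do under eq_bigr do rewrite -VE//.
  exact: measure_semi_sigma_additive.
have VC A : measurable A -> V A + V (~` A) = 1.
  move=> mA; have mA' := measurableC mA.
  have V0' : (V set0)%:E = 0%E by rewrite V0.
  have /semi_additiveW := semi_sigma_additive_is_additive V0' sigmaV.
  move=> /(_ V0' A (~` A) mA mA'); rewrite setUv setICr V1.
  by move=> /(_ measurableT erefl)[<-].
have VE A : measurable A -> P A = (V A)%:E.
  by move=> mA; apply: (upper_selfconjugate VL LP mA); exact: VC.
move=> B C mB mC; have [c cvB /(_ _ LP)] := cvC C mC.
(* [P] coincides with the invariant [V], so all preimages of [C] have measure [V C]; this identifies
   [c]. *)
have -> : (fun n => mean_measure T P C n.+1) = cst (V C).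
  apply/funext => n; rewrite /mean_measure /=.
  rewrite (eq_bigr (fun=> V C)) => [|i _]; last first.
    by rewrite VE ?(upper_preimage_iter mT invV)//; exact: measurable_preimage_iter.
  by rewrite sumr_const card_ord -(mulr_natl (V C)) mulrA mulVf ?mul1r.
move=> /cvg_lim h1.
suff -> : V C = c by exact: cvB.
by rewrite -h1 ?lim_cst.
Qed.
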